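(* Let $(X,A_\tau,\rightarrow)$ be a labelled transition system and let $(X,\pi_X\circ\alpha)$ be the corresponding $\mathcal P\circ\mathrm{Path}_\sim$-coalgebra (defined in the context). Then two states $x,x'\in X$ are branching bisimilar if and only if $x$ and $x'$ are $\mathcal P\circ\mathrm{Path}_\sim$-behaviourally equivalent, i.e. there exist a set $Y$, a function $\beta:Y\to\mathcal P(\mathrm{Path}_\sim Y)$ and a function $f:X\to Y$ with $\mathcal P(\mathrm{Path}_\sim f)\circ\pi_X\circ\alpha=\beta\circ f$ and $f(x)=f(x')$.
   Context: Fix a set $A$ of actions and a silent action $\tau\notin A$; $A_\tau=A\cup\{\tau\}$, $A_\tau^*$ is the set of finite words, $\epsilon$ the empty word, $\preceq$ the prefix order on words and ${\downarrow}\sigma=\{\sigma'\mid\sigma'\preceq\sigma\}$. A path on a set $X$ is a function $p$ with codomain $X$ whose domain is ${\downarrow}\sigma$ for some $\sigma\in A_\tau^*$; $\mathrm{Path}(X)$ is the set of paths, $\mathrm{trace}(p)=\max\mathrm{dom}\,p$, $\mathrm{last}(p)=p(\mathrm{trace}(p))$. A stutter basis of $p$ is the (unique) function $\phi:\mathrm{dom}\,p\to A_\tau^*$ with $\phi(\epsilon)=\epsilon$; $\phi(\sigma'\tau)=\phi(\sigma')$ if $p(\sigma'\tau)=p(\sigma')$; $\phi(\sigma'\tau)=\phi(\sigma')\tau$ if $p(\sigma'\tau)\ne p(\sigma')$; $\phi(\sigma'a)=\phi(\sigma')a$ for $a\in A$. The stutter invariant path $\mathrm{st}(p)$ is the function with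 domain $\phi(\mathrm{dom}\,p)$ (a prefix-closed set of prefixes of a word) such that $\mathrm{st}(p)\circ\phi=p$. Paths $p,q$ are stutter equivalent, $p\sim q$, iff $\mathrm{st}(p)=\mathrm{st}(q)$; $\mathrm{Path}_\sim(X)=\mathrm{Path}(X)/{\sim}$, $\pi_X$ is the quotient map, and for $f:X\to Y$, $\mathrm{Path}_\sim f([p]_\sim)=[f\circ p]_\sim$. $\mathcal P$ is the covariant powerset functor on sets. A labelled transition system is $(X,A_\tau,\rightarrow)$ with $\rightarrow\subseteq X\times A_\tau\times X$, written $x\xrightarrow{a}x'$. An execution from $x$ is a path $p$ with $p(\epsilon)=x$ and $p(\sigma)\xrightarrow{a}p(\sigma a)$ for all $\sigma a\in\mathrm{dom}\,p$; $\mathrm{exec}(x)$ is the set of these. Define $\alpha(x)=\{p\in\mathrm{exec}(x)\mid \mathrm{trace}(p)\in\tau^*a \text{ for some } a\in A_\tau\}\cup\{p\in\mathrm{exec}(x)\mid\mathrm{trace}(p)\in\tau^*\}$. Write $y\Rightarrow y'$ if $y'$ is reachable from $y$ by zero or more $\tau$-transitions. A symmetric relation $R\subseteq X\times X$ is a branching bisimulation if whenever $x\xrightarrow{a}x'$ and $xRy$, either ($a=\tau$ and $x'Ry$) or there exist $y',y''$ with $y\Rightarrow y'\xrightarrow{a}y''$, $xRy'$ and $x'Ry''$. Two states are branching bisimilar if some branching bisimulation relates them. *)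

(* Defs.v *)
From HB Require Import structures.
From Stdlib Require Import Relation_Operators.
From mathcomp Require Import all_boot generic_quotient.
From mathcomp Require Import boolp classical_sets.

Set Implicit Arguments.
Unset Strict Implicit.
Unset Printing Implicit Defensive.

Local Open Scope quotient_scope.
Local Open Scope classical_set_scope.

(* Words over A_tau = A + {tau}: [Some a] is the visible action a and [None]
   is tau.  [rcons w a] is the word w followed by the letter a. *)
Notation word A := (seq (option A)).

(* The prefix order, with [A] an arbitrary type ([seq.prefix] needs an
   [eqType]). *)
Definition prefix_of A (w s : word A) : Prop := exists t, s = w ++ t.

(* A path is a function with domain the set of prefixes of a word, encoded as
   a partial function ([None] = undefined).  The field [trace] is determined
   by the partial function, being the maximum of its domain; see [path_ext]. *)
Record Path (A X : Type) := MkPath {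
  trace : word A;
  pfun :> word A -> option X;
  pfun_dom : forall w, pfun w <> None <-> prefix_of w trace }.

Section Words.
Context {A : Type}.
Implicit Types (w s t : word A) (a : option A).

Lemma prefix_of_refl w : prefix_of w w.
Proof. by exists [::]; rewrite cats0. Qed.

Lemma prefix_of_nil w : prefix_of [::] w.
Proof. by exists w. Qed.

Lemma prefix_of_trans w s t : prefix_of w s -> prefix_of s t -> prefix_of w t.
Proof. by move=> [u ->] [v ->]; exists (u ++ v); rewrite catA. Qed.

Lemma prefix_of_rconsW w a s : prefix_of (rcons w a) s -> prefix_of w s.
Proof. by apply: prefix_of_trans; exists [:: a]; rewrite cats1. Qed.

Lemma prefix_of_anti w s : prefix_of w s -> prefix_of s w -> w = s.
Proof.
move=> [u ->] [v] /(congr1 size); rewrite !size_cat -addnA -{1}[size w]addn0.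
by move/addnI; case: u => [|//]; rewrite cats0.
Qed.

Lemma prefix_of_rcons w s a :
  prefix_of w (rcons s a) <-> prefix_of w s \/ w = rcons s a.
Proof.
split=> [[t]|[[t ->]|->]]; last 2 first.
- by exists (rcons t a); rewrite rcons_cat.
- exact: prefix_of_refl.
case: (lastP t) => [|u b]; first by rewrite cats0 => <-; right.
by rewrite -rcons_cat => /rcons_inj [-> _]; left; exists u.
Qed.

End Words.

Section PathTheory.
Context {A : Type}.

Lemma path_ext X (p q : Path A X) : pfun p = pfun q -> p = q.
Proof.
case: p q => [s f hf] [t g hg] /= e; rewrite e in hf *.
have est : s = t.
  by apply: prefix_of_anti; [apply/hg/hf | apply/hf/hg]; exact: prefix_of_refl.
by rewrite est in hf *; congr MkPath; exact: Prop_irrelevance.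
Qed.

Lemma path_comp_dom X Y (f : X -> Y) (p : Path A X) w :
  omap f (p w) <> None <-> prefix_of w (trace p).
Proof. by rewrite -pfun_dom; case: (pfun p w). Qed.

Definition path_comp X Y (f : X -> Y) (p : Path A X) : Path A Y :=
  MkPath (path_comp_dom f p).

End PathTheory.

Section Stutter.
Context {A X : Type}.
Implicit Types (p q : Path A X) (w s v : word A) (a : option A).

(* Recursion on the reversed word, so that the defining equations
   [stutter_basis_nil], [stutter_basis_tau] and [stutter_basis_act] peel off
   the last letter. Only the values on the domain of [p] are meaningful. *)
Fixpoint stutter_basis_rev p (r : word A) : word A :=
  match r with
  | [::] => [::]
  | Some a :: r' => rcons (stutter_basis_rev p r') (Some a)
  | None :: r' =>
      if pselect (p (rev (None :: r')) = p (rev r'))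
      then stutter_basis_rev p r' else rcons (stutter_basis_rev p r') None
  end.

Definition stutter_basis p w := stutter_basis_rev p (rev w).

Lemma stutter_basis_nil p : stutter_basis p [::] = [::].
Proof. by []. Qed.

Lemma stutter_basis_tau p w :
  stutter_basis p (rcons w None) =
    if pselect (p (rcons w None) = p w) then stutter_basis p w
    else rcons (stutter_basis p w) None.
Proof. by rewrite /stutter_basis rev_rcons /= rev_cons revK. Qed.

Lemma stutter_basis_act p w (a : A) :
  stutter_basis p (rcons w (Some a)) = rcons (stutter_basis p w) (Some a).
Proof. by rewrite /stutter_basis rev_rcons. Qed.

Lemma stutter_basis_unique p (phi : word A -> word A) :
  phi [::] = [::] ->
  (forall w, prefix_of (rcons w None) (trace p) ->
     p (rcons w None) = p w -> phi (rcons w None) = phi w) ->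
  (forall w, prefix_of (rcons w None) (trace p) ->
     p (rcons w None) <> p w -> phi (rcons w None) = rcons (phi w) None) ->
  (forall w (a : A), prefix_of (rcons w (Some a)) (trace p) ->
     phi (rcons w (Some a)) = rcons (phi w) (Some a)) ->
  forall w, prefix_of w (trace p) -> phi w = stutter_basis p w.
Proof.
move=> h0 h1 h2 h3; elim/last_ind => [//|w [a|] IH] hw.
  by rewrite h3// IH ?stutter_basis_act//; exact: prefix_of_rconsW hw.
have {}IH := IH (prefix_of_rconsW hw).
rewrite stutter_basis_tau; case: pselect => /= e; first by rewrite h1.
by rewrite h2// IH.
Qed.

Lemma stutter_basis_step p w a :
  (stutter_basis p (rcons w a) = stutter_basis p w /\ p (rcons w a) = p w) \/
  stutter_basis p (rcons w a) = rcons (stutter_basis p w) a.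
Proof.
case: a => [a|]; first by right; rewrite stutter_basis_act.
by rewrite stutter_basis_tau; case: pselect => /= e; [left|right].
Qed.

Lemma stutter_basis_prefix p w s :
  prefix_of w s -> prefix_of (stutter_basis p w) (stutter_basis p s).
Proof.
move=> [t ->]; elim/last_ind: t => [|t a IH].
  by rewrite cats0; exact: prefix_of_refl.
rewrite -rcons_cat; have [[-> _]//|->] := stutter_basis_step p (w ++ t) a.
by apply/prefix_of_rcons; left.
Qed.

Lemma stutter_basis_onto p v s :
  prefix_of v (stutter_basis p s) ->
  exists2 w, prefix_of w s & stutter_basis p w = v.
Proof.
elim/last_ind: s v => [|s a IH] v.
  by move=> [t]; case: v => // _; exists [::] => //; exact: prefix_of_nil.
have H : prefix_of v (stutter_basis p s) ->
    exists2 w, prefix_of w (rcons s a) & stutter_basis p w = v.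
  by move=> /IH[w ws <-]; exists w => //; apply/prefix_of_rcons; left.
have [[e _]|e] := stutter_basis_step p s a; rewrite e; first exact: H.
move=> /prefix_of_rcons[//|->].
by exists (rcons s a) => //; exact: prefix_of_refl.
Qed.

Lemma stutter_basis_val p w s :
  prefix_of w (trace p) -> prefix_of s (trace p) ->
  stutter_basis p w = stutter_basis p s -> p w = p s.
Proof.
have mono u t : stutter_basis p u = stutter_basis p (u ++ t) ->
    p u = p (u ++ t).
  elim/last_ind: t => [|t a IH]; first by rewrite cats0.
  rewrite -rcons_cat => e.
  have [[e1 e2]|e1] := stutter_basis_step p (u ++ t) a.
    by rewrite e2 -IH// -e1.
  have : prefix_of (stutter_basis p u) (stutter_basis p (u ++ t)).
    by apply: stutter_basis_prefix; exists t.
  move: e; rewrite e1 => -> [t'] /(congr1 size).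
  by rewrite size_cat size_rcons => /eqP; rewrite addSn -addnS -{1}[size _]addn0
    eqn_add2l.
move=> [w' hw] [s' hs].
wlog le_ws : w w' s s' hw hs / size w <= size s.
  move=> W e; have [l|/ltnW l] := leqP (size w) (size s).
    exact: (W w w' s s').
  by symmetry; apply: (W s s' w w').
have -> : s = w ++ drop (size w) s.
  have : take (size w) (s ++ s') = w by rewrite -hs hw take_size_cat.
  by rewrite takel_cat// => {1}<-; rewrite cat_take_drop.
exact: mono.
Qed.

(* The function with domain phi(dom p) such that st(p) o phi = p, with phi
   the stutter basis; see [st_fun_basis]. *)
Definition st_fun p v : option X :=
  if pselect (exists w, prefix_of w (trace p) /\ stutter_basis p w = v) is left h
  then p (projT1 (cid h)) else None.

Lemma st_fun_basis p w :
  prefix_of w (trace p) -> st_fun p (stutter_basis p w) = p w.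
Proof.
move=> hw; rewrite /st_fun; case: pselect => [h|[]]; last by exists w.
by case: (cid h) => s /= [hs e]; exact: stutter_basis_val.
Qed.

Lemma st_fun_dom p v :
  st_fun p v <> None <-> prefix_of v (stutter_basis p (trace p)).
Proof.
split=> [|/stutter_basis_onto[w hw <-]].
  rewrite /st_fun; case: pselect => // h _; have [w [hw <-]] := h.
  exact: stutter_basis_prefix.
by rewrite st_fun_basis//; apply/pfun_dom.
Qed.

Definition st p : Path A X := MkPath (st_fun_dom p).

Definition stutter_equiv p q : bool := `[< st p = st q >].

Lemma stutter_equivP p q : reflect (st p = st q) (stutter_equiv p q).
Proof. exact: asboolP. Qed.

Lemma stutter_equiv_refl : reflexive stutter_equiv.
Proof. by move=> p; apply/stutter_equivP. Qed.

Lemma stutter_equiv_sym : symmetric stutter_equiv.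
Proof. by move=> p q; apply/stutter_equivP/stutter_equivP. Qed.

Lemma stutter_equiv_trans : transitive stutter_equiv.
Proof.
move=> q p r /stutter_equivP e /stutter_equivP f; apply/stutter_equivP.
by rewrite e.
Qed.

Canonical stutter_equiv_rel := EquivRel stutter_equiv
  stutter_equiv_refl stutter_equiv_sym stutter_equiv_trans.

End Stutter.

HB.instance Definition _ A X := gen_eqMixin (Path A X).
HB.instance Definition _ A X := gen_choiceMixin (Path A X).

Definition StPath (A X : Type) : Type :=
  {eq_quot (@stutter_equiv_rel A X)}.

Definition st_class {A X} (p : Path A X) : StPath A X :=
  \pi_({eq_quot (@stutter_equiv_rel A X)}) p.

Definition st_repr {A X} (c : StPath A X) : Path A X :=
  repr (c : {eq_quot (@stutter_equiv_rel A X)}).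

Lemma st_reprK A X (c : StPath A X) : st_class (st_repr c) = c.
Proof. exact: reprK. Qed.

Lemma st_classP A X (p q : Path A X) : st_class p = st_class q <-> st p = st q.
Proof.
split=> [/eqmodP/stutter_equivP//|e]; exact/eqmodP/stutter_equivP.
Qed.

(* Independent of the chosen representative: see [StPath_map_class]. *)
Definition StPath_map {A X Y} (f : X -> Y) (c : StPath A X) : StPath A Y :=
  st_class (path_comp f (st_repr c)).

Lemma st_comp_st A X Y (f : X -> Y) (p : Path A X) :
  st (path_comp f p) = st (path_comp f (st p)).
Proof.
set fp := path_comp f p; set fs := path_comp f (st p).
have stp w : prefix_of w (trace p) -> fs (stutter_basis p w) = fp w.
  by move=> hw /=; rewrite st_fun_basis.
have basis w : prefix_of w (trace p) ->
    stutter_basis fp w = stutter_basis fs (stutter_basis p w).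
  elim/last_ind: w => [//|w a IH] hw; have hw' := prefix_of_rconsW hw.
  have {}IH := IH hw'; case: a hw => [a|] hw.
    by rewrite !stutter_basis_act IH.
  have Ep := stutter_basis_tau p w; have Ef := stutter_basis_tau fp w.
  move: Ep Ef; case: pselect => /= e; case: pselect => //= e' Ep Ef.
  - by rewrite Ef Ep.
  - by case: e'; rewrite e.
  - rewrite Ef Ep stutter_basis_tau; case: pselect => //= -[].
    by move: (stp _ hw) (stp _ hw'); rewrite Ep /= => -> ->.
  - rewrite Ef Ep stutter_basis_tau IH; case: pselect => //= e2; case: e'.
    by move: (stp _ hw) (stp _ hw'); rewrite Ep /= => <- <-.
apply: path_ext; apply/funext => v /=.
have [[w [hw <-]]|nv] :=
    pselect (exists w, prefix_of w (trace p) /\ stutter_basis fp w = v).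
  rewrite (@st_fun_basis _ _ fp)// basis// (@st_fun_basis _ _ fs) ?stp//.
  exact: stutter_basis_prefix.
have -> : st_fun fp v = None by rewrite /st_fun; case: pselect.
rewrite /st_fun; case: pselect => // -[u [hu e]]; case: nv.
have [w hw eu] := stutter_basis_onto hu.
by exists w; split => //; rewrite basis// eu.
Qed.

Lemma StPath_map_class A X Y (f : X -> Y) (p : Path A X) :
  StPath_map f (st_class p) = st_class (path_comp f p).
Proof.
apply/st_classP; rewrite st_comp_st [RHS]st_comp_st.
by congr (st (path_comp f _)); apply/st_classP; exact: st_reprK.
Qed.

(* The functor P o Path_~; [set] is the covariant powerset, acting on
   functions by direct image. *)
Definition PStPath (A X : Type) : Type := set (StPath A X).

Definition PStPath_map {A X Y} (f : X -> Y) (C : PStPath A X) : PStPath A Y :=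
  StPath_map f @` C.

Definition behaviourally_equivalent (F : Type -> Type)
    (Fmap : forall X Y : Type, (X -> Y) -> F X -> F Y)
    (X : Type) (c : X -> F X) (x x' : X) : Prop :=
  exists (Y : Type) (beta : Y -> F Y) (f : X -> Y),
    Fmap X Y f \o c = beta \o f /\ f x = f x'.

Section LTS.
Context {A X : Type} (tr : X -> option A -> X -> Prop).

(* The domain is prefix-closed, so the second condition ranges over all
   [rcons w a] in the domain of [p]. *)
Definition exec (x : X) : set (Path A X) := [set p |
  p [::] = Some x /\
  forall w a y y', p w = Some y -> p (rcons w a) = Some y' -> tr y a y'].

Definition alpha (x : X) : set (Path A X) :=
  [set p | exec x p /\ exists n a, trace p = rcons (nseq n None) a] `|`
  [set p | exec x p /\ exists n, trace p = nseq n None].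

Definition lts_coalgebra (x : X) : PStPath A X := st_class @` alpha x.

Definition tau_reach : X -> X -> Prop :=
  clos_refl_trans X (fun y y' => tr y None y').

Definition branching_bisimulation (R : X -> X -> Prop) : Prop :=
  (forall x y, R x y -> R y x) /\
  forall x a x' y, tr x a x' -> R x y ->
    (a = None /\ R x' y) \/
    exists y' y'', tau_reach y y' /\ tr y' a y'' /\ R x y' /\ R x' y''.

Definition branching_bisimilar (x y : X) : Prop :=
  exists R, branching_bisimulation R /\ R x y.

End LTS.

(* Main.v *)
(* For the "if" direction, the kernel of a coalgebra morphism [f] is a
   branching bisimulation: a step [x -a-> x'] is a path of [alpha x], and a path
   [q] of [alpha y] with [f \o q] stutter equivalent to its image either shows
   that the step is inert or contains a step labelled [a] reached by tau steps
   that [f] does not see.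

   For the "only if" direction, one takes [f] to be the quotient by
   bisimilarity.  Composing branching bisimulations need not give one, so we
   pass to semi-branching bisimulations (Basten), where an inert step may be
   answered by tau steps.  Their union is an equivalence and has the stuttering
   property: states on a tau path between equivalent states are equivalent.
   Hence the tau steps preceding an answering step are invisible in the
   quotient, and paths from [x] are matched, transition by transition, by paths
   from [y] up to stutter equivalence. *)

From Stdlib Require Import Relation_Operators Operators_Properties.
From mathcomp Require Import all_boot.
From mathcomp Require Import boolp classical_sets.
Require Import Defs.

Set Implicit Arguments.
Unset Strict Implicit.
Unset Printing Implicit Defensive.

Local Open Scope classical_set_scope.

(** * Prefixes of words *)

Section Words.
Context {A : Type}.
Implicit Types (w s : word A) (a : option A).

Lemma prefix_of_0 w : prefix_of w [::] <-> w = [::].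
Proof.
split=> [[t]|->]; first by case: w.
exact: prefix_of_refl.
Qed.

Lemma rcons_not_prefix_of s a : ~ prefix_of (rcons s a) s.
Proof.
move=> [t] /(congr1 size); rewrite size_cat size_rcons => e.
by have := leq_addr (size t) (size s).+1; rewrite -e ltnn.
Qed.

End Words.

(** * Paths extended by one letter *)

Section PathExtension.
Context {A X : Type}.
Implicit Types (p q : Path A X) (w s : word A) (a : option A) (x y : X).

Lemma path_out p w : ~ prefix_of w (trace p) -> p w = None.
Proof. by move=> h; apply: contra_notP h => /pfun_dom. Qed.

Lemma path_ext_dom p q :
  trace p = trace q -> (forall w, prefix_of w (trace p) -> p w = q w) -> p = q.
Proof.
move=> et e; apply: path_ext; apply/funext => w.
have [/e//|n] := pselect (prefix_of w (trace p)).
by rewrite !path_out// -et.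
Qed.

Lemma path_trace_neq p : p (trace p) <> None.
Proof. by apply/pfun_dom; exact: prefix_of_refl. Qed.

Lemma unit_path_dom x w :
  (if pselect (w = [::]) then Some x else None) <> None <->
  prefix_of w ([::] : word A).
Proof. by rewrite prefix_of_0; case: pselect. Qed.

Definition unit_path x : Path A X := MkPath (unit_path_dom x).

Lemma unit_pathE x : unit_path x [::] = Some x.
Proof. by rewrite /=; case: pselect. Qed.

Lemma snoc_path_dom p a y w :
  (if pselect (w = rcons (trace p) a) then Some y else p w) <> None <->
  prefix_of w (rcons (trace p) a).
Proof.
rewrite prefix_of_rcons -pfun_dom.
case: pselect => [e|n]; first by split=> // _; right.
by split=> [h|[]//]; left.
Qed.

Definition snoc_path p a y : Path A X := MkPath (snoc_path_dom p a y).

Lemma snoc_path_last p a y : snoc_path p a y (rcons (trace p) a) = Some y.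
Proof. by rewrite /=; case: pselect. Qed.

Lemma snoc_path_prefix p a y w :
  prefix_of w (trace p) -> snoc_path p a y w = p w.
Proof.
move=> hw /=; case: pselect => // e.
by case: (@rcons_not_prefix_of _ (trace p) a); rewrite -e.
Qed.

Lemma path_prefix_dom p s : prefix_of s (trace p) -> forall w,
  (if pselect (prefix_of w s) then p w else None) <> None <-> prefix_of w s.
Proof.
move=> hs w; case: pselect => // h; split=> // _.
by apply/pfun_dom; exact: prefix_of_trans hs.
Qed.

Definition path_prefix p s (hs : prefix_of s (trace p)) : Path A X :=
  MkPath (path_prefix_dom hs).

(** Allows induction on the length of the trace; the shorter path is the restriction to the prefixes
    of [s]. *)
Lemma path_rcons p s a : trace p = rcons s a ->
  exists p0 y, trace p0 = s /\ p = snoc_path p0 a y.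
Proof.
move=> et.
have hs : prefix_of s (trace p).
  by rewrite et; apply/prefix_of_rcons; left; exact: prefix_of_refl.
case ey : (p (trace p)) => [y|]; last by have := @path_trace_neq p.
exists (path_prefix hs), y; split=> //; apply: path_ext_dom => //= w hw.
case: pselect => [ew|n] /=; first by rewrite -ey et ew.
case: pselect => // n'; case: n'.
by move: hw; rewrite et => /prefix_of_rcons[].
Qed.

End PathExtension.

Lemma path_comp_snoc A X Y (f : X -> Y) (p : Path A X) a y :
  path_comp f (snoc_path p a y) = snoc_path (path_comp f p) a (f y).
Proof. by apply: path_ext; apply/funext => w /=; case: pselect. Qed.

(** * Stutter invariant paths under extension by one step *)

Section StutterExtension.
Context {A X : Type}.
Implicit Types (p q s : Path A X) (w : word A) (a : option A) (y : X).

(** Every word in the domain of [st p] is a value of the stutter basis on the domain of [p], so the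
    second condition fixes all values. *)
Lemma st_unique p s :
  trace s = stutter_basis p (trace p) ->
  (forall w, prefix_of w (trace p) -> s (stutter_basis p w) = p w) ->
  st p = s.
Proof.
move=> et e; apply: path_ext_dom => //= _ /stutter_basis_onto[w hw <-].
by rewrite e// st_fun_basis.
Qed.

Lemma st_last p : st p (trace (st p)) = p (trace p).
Proof. by apply: st_fun_basis; exact: prefix_of_refl. Qed.

Lemma stutter_basis_snoc p a y w : prefix_of w (trace p) ->
  stutter_basis (snoc_path p a y) w = stutter_basis p w.
Proof.
elim/last_ind: w => [//|w [b|] IH] hw; have hw' := prefix_of_rconsW hw.
  by rewrite !stutter_basis_act IH.
by rewrite !stutter_basis_tau !snoc_path_prefix// IH.
Qed.

Lemma st_snoc_stutter p y :
  p (trace p) = Some y -> st (snoc_path p None y) = st p.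
Proof.
move=> ey; have hr := prefix_of_refl (trace p).
have eb : stutter_basis (snoc_path p None y) (rcons (trace p) None) =
          stutter_basis p (trace p).
  rewrite stutter_basis_tau snoc_path_last snoc_path_prefix// stutter_basis_snoc//.
  by case: pselect => // -[].
apply: st_unique => [|w /prefix_of_rcons[hw|->]]; first by rewrite /= eb.
  by rewrite stutter_basis_snoc// snoc_path_prefix//; exact: st_fun_basis.
by rewrite eb snoc_path_last -ey; exact: st_fun_basis.
Qed.

Lemma st_snoc p a y : ~ (a = None /\ p (trace p) = Some y) ->
  st (snoc_path p a y) = snoc_path (st p) a y.
Proof.
move=> ns; have hr := prefix_of_refl (trace p).
have eb : stutter_basis (snoc_path p a y) (rcons (trace p) a) =
          rcons (stutter_basis p (trace p)) a.
  rewrite -(stutter_basis_snoc a y hr).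
  have [[_]|//] := stutter_basis_step (snoc_path p a y) (trace p) a.
  rewrite snoc_path_last snoc_path_prefix// => e.
  case: a ns => [a|] ns; first by rewrite stutter_basis_act.
  by case: ns.
apply: st_unique => [|w /prefix_of_rcons[hw|->]]; first by rewrite /= eb.
  rewrite stutter_basis_snoc// !snoc_path_prefix//; first exact: st_fun_basis.
  exact: stutter_basis_prefix.
by rewrite eb [LHS]snoc_path_last [RHS]snoc_path_last.
Qed.

(** Whether the new step stutters depends only on its letter, the new state and the last state, and
    [st] keeps the last state. *)
Lemma st_snoc_congr p q a y :
  st p = st q -> st (snoc_path p a y) = st (snoc_path q a y).
Proof.
move=> e; have el : p (trace p) = q (trace q) by rewrite -st_last e st_last.
have [[-> ep]|ns] := pselect (a = None /\ p (trace p) = Some y).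
  by rewrite !st_snoc_stutter// -el.
by rewrite !st_snoc ?e// -el.
Qed.

(** The basis never drops a visible letter. *)
Lemma stutter_basis_nil_tau p w :
  stutter_basis p w = [::] -> exists n, w = nseq n None.
Proof.
elim/last_ind: w => [|w a IH] e; first by exists 0.
have [[e' _]|e'] := stutter_basis_step p w a; last first.
  by move: e; rewrite e'; case: (stutter_basis p w).
have [n ew] : exists n, w = nseq n None by apply: IH; rewrite -e'.
case: a e {e'} => [a|_]; first by rewrite stutter_basis_act; case: (stutter_basis p w).
by exists n.+1; rewrite ew -[n.+1]addn1 nseqD cats1.
Qed.

(** Locates the step at which the basis grows; all letters before it are silent by
    [stutter_basis_nil_tau]. *)
Lemma stutter_basis_letter p w a : stutter_basis p w = [:: a] ->
  exists w', [/\ prefix_of (rcons w' a) w, stutter_basis p w' = [::]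
    & stutter_basis p (rcons w' a) = [:: a]].
Proof.
elim/last_ind: w => [//|w b IH] e.
have [[e' _]|e'] := stutter_basis_step p w b.
  have [w' [h1 h2 h3]] := IH (etrans (esym e') e).
  by exists w'; split=> //; apply/prefix_of_rcons; left.
have /rcons_inj[eb ea] : rcons [::] a = rcons (stutter_basis p w) b.
  by rewrite -e' e.
by subst b; exists w; split=> //; exact: prefix_of_refl.
Qed.

End StutterExtension.

(** * Executions under extension by one step *)

Section Executions.
Context {A X : Type} (tr : X -> option A -> X -> Prop).
Implicit Types (p q : Path A X) (w : word A) (a : option A) (x y z : X).

Lemma exec_unit x : exec tr x (unit_path x).
Proof.
split=> [|w a y y' _ /=]; first exact: unit_pathE.
by case: pselect => //; case: w.
Qed.

Lemma exec_snoc x p a y z : exec tr x p -> p (trace p) = Some z ->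
  tr z a y -> exec tr x (snoc_path p a y).
Proof.
move=> [p0 pS] ez zay; split.
  by rewrite snoc_path_prefix//; exact: prefix_of_nil.
move=> w b y1 y2 ew ewb.
have /prefix_of_rcons[h|/rcons_inj[? ?]] :
    prefix_of (rcons w b) (trace (snoc_path p a y)).
  by apply/pfun_dom; rewrite ewb.
  move: ew ewb; rewrite !snoc_path_prefix//; last exact: prefix_of_rconsW h.
  exact: pS.
subst w b; move: ew ewb; rewrite snoc_path_last snoc_path_prefix.
  by rewrite ez => -[<-] [<-].
exact: prefix_of_refl.
Qed.

Lemma exec_snoc_inv x p a y : exec tr x (snoc_path p a y) ->
  exec tr x p /\ exists2 z, p (trace p) = Some z & tr z a y.
Proof.
move=> [p0 pS]; split.
  split; first by rewrite -p0 snoc_path_prefix//; exact: prefix_of_nil.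
  move=> w b y1 y2 ew ewb.
  have h : prefix_of (rcons w b) (trace p) by apply/pfun_dom; rewrite ewb.
  apply: (pS w); rewrite snoc_path_prefix//; exact: prefix_of_rconsW h.
case ez : (p (trace p)) => [z|]; last by have := @path_trace_neq _ _ p.
exists z => //; apply: (pS (trace p)); last exact: snoc_path_last.
by rewrite snoc_path_prefix//; exact: prefix_of_refl.
Qed.

Lemma exec_tau_reach x p n y :
  exec tr x p -> p (nseq n None) = Some y -> tau_reach tr x y.
Proof.
move=> [p0 pS]; elim: n y => [|n IH] y; first by rewrite p0 => -[->]; apply: rt_refl.
rewrite -[n.+1]addn1 nseqD cats1 => ey.
have h : prefix_of (nseq n None) (trace p).
  by apply: (@prefix_of_rconsW _ _ None); apply/pfun_dom; rewrite ey.
case ez : (p (nseq n None)) => [z|]; last by move/pfun_dom: h.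
apply: rt_trans (IH _ ez) _; apply: rt_step; exact: pS ez ey.
Qed.

End Executions.

(** * Semi-branching bisimilarity *)

Section SemiBranching.
Context {A X : Type} (tr : X -> option A -> X -> Prop).
Implicit Types (R : X -> X -> Prop) (a : option A) (x y z : X).

Let reach := tau_reach tr.

Definition semi_branching R : Prop :=
  (forall x y, R x y -> R y x) /\
  forall x a x' y, tr x a x' -> R x y ->
    (a = None /\ exists y', reach y y' /\ R x y' /\ R x' y') \/
    exists y' y'', reach y y' /\ tr y' a y'' /\ R x y' /\ R x' y''.

Definition semi_bisimilar x y := exists R, semi_branching R /\ R x y.

Lemma branching_semi R : branching_bisimulation tr R -> semi_branching R.
Proof.
move=> [sR bR]; split=> // x a x' y xax' xy.
have [[-> x'y]|] := bR _ _ _ _ xax' xy; last by right.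
by left; split=> //; exists y; split=> //; exact: rt_refl.
Qed.

Lemma semi_branching_bisimilar : semi_branching semi_bisimilar.
Proof.
split=> [x y [R [[sR bR] xy]]|x a x' y xax' [R [hR xy]]].
  by exists R; split=> //; exact: sR.
have [[-> [y' [r [h1 h2]]]]|[y' [y'' [r [t [h1 h2]]]]]] := hR.2 _ _ _ _ xax' xy.
  by left; split=> //; exists y'; do !split=> //; exists R.
by right; exists y', y''; do !split=> //; exists R.
Qed.

Lemma semi_bisimilar_refl x : semi_bisimilar x x.
Proof.
exists eq; split=> //; split=> // y a y' _ yay' <-.
by right; exists y, y'; do !split=> //; exact: rt_refl.
Qed.

Lemma semi_bisimilar_sym x y : semi_bisimilar x y -> semi_bisimilar y x.
Proof. exact: semi_branching_bisimilar.1. Qed.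

(** Either clause of the definition answers a single silent step by a tau path; these paths are
    concatenated. *)
Lemma semi_branching_reach R x x' y : semi_branching R ->
  reach x x' -> R x y -> exists2 y', reach y y' & R x' y'.
Proof.
move=> hR xx'; elim: xx' y => {x x'} [x x' t|x|x x1 x' _ IH1 _ IH2] y xy.
- have [[_ [y' [r [_ h]]]]|[y' [y'' [r [t' [_ h]]]]]] := hR.2 _ _ _ _ t xy.
    by exists y'.
  by exists y'' => //; apply: rt_trans r _; exact: rt_step.
- by exists y => //; exact: rt_refl.
- have [y1 r1 /IH2[y' r2 h]] := IH1 _ xy.
  by exists y' => //; apply: rt_trans r1 r2.
Qed.

Lemma semi_bisimilar_trans x y z :
  semi_bisimilar x y -> semi_bisimilar y z -> semi_bisimilar x z.
Proof.
have hB := semi_branching_bisimilar; move=> xy yz.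
exists (fun u w => exists2 v, semi_bisimilar u v & semi_bisimilar v w).
split; last by exists y.
split=> [u w [v uv vw]|u a u' w uau' [v uv vw]].
  by exists v; exact: semi_bisimilar_sym.
have [[-> [v' [r [h1 h2]]]]|[v' [v'' [r [t [h1 h2]]]]]] := hB.2 _ _ _ _ uau' uv;
  have [w1 r1 k1] := semi_branching_reach hB r vw.
  by left; split=> //; exists w1; do !split=> //; exists v'.
(* The step from [v'] to [v''] is answered in turn from [w1]. An inert answer relates [u'] to a
   state reached from [w], not to [w] itself, which is what the semi-branching clause admits. *)
have [[-> [w2 [r2 [k2 k3]]]]|[w2 [w3 [r2 [t2 [k2 k3]]]]]] := hB.2 _ _ _ _ t k1.
  left; split=> //; exists w2; split; first exact: rt_trans r1 r2.
  by split; [exists v'|exists v''].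
right; exists w2, w3; split; first exact: rt_trans r1 r2.
by do !split=> //; [exists v'|exists v''].
Qed.

(** The pair of [y] and [z] can be added to bisimilarity: [z] answers a step of [y] by first walking
    to [y'], and [y] answers a step of [z] by first walking to [z]. *)
Lemma semi_bisimilar_stuttering y z y' :
  reach y z -> reach z y' -> semi_bisimilar y y' -> semi_bisimilar y z.
Proof.
move=> yz zy' yy'.
have hB := semi_branching_bisimilar.
pose S u v := [\/ semi_bisimilar u v, u = y /\ v = z | u = z /\ v = y].
exists S; split; last by apply: Or32.
split=> [u v [/semi_bisimilar_sym|[-> ->]|[-> ->]]|u a u' v uau'].
- by move=> ?; apply: Or31.
- by apply: Or33.
- by apply: Or32.
have BS s t : semi_bisimilar s t -> S s t by move=> ?; apply: Or31.
(* Used with [w] equal to [v] for bisimilar pairs, and with [w] equal to [y'] for the added pair. *)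
have lift w : reach v w -> semi_bisimilar u w ->
    (a = None /\ exists v', reach v v' /\ S u v' /\ S u' v') \/
    exists v' v'', reach v v' /\ tr v' a v'' /\ S u v' /\ S u' v''.
  move=> vw uw.
  have [[-> [v' [r [h1 h2]]]]|[v' [v'' [r [t [h1 h2]]]]]] := hB.2 _ _ _ _ uau' uw.
    left; split=> //; exists v'; split; first exact: rt_trans vw r.
    by split; exact: BS.
  right; exists v', v''; split; first exact: rt_trans vw r.
  by do !split=> //; exact: BS.
move=> [uv|[eu ev]|[eu ev]].
- by apply: lift uv; exact: rt_refl.
- by apply: (lift y'); rewrite ?eu ?ev.
- right; exists u, u'; split; first by rewrite eu ev.
  by do !split=> //; apply: BS; exact: semi_bisimilar_refl.
Qed.

(** In the inert case [x'], [y'], [x] and [y] are all bisimilar, so by transitivity [y] can answer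
    without moving. *)
Lemma semi_bisimilar_branching : branching_bisimulation tr semi_bisimilar.
Proof.
have hB := semi_branching_bisimilar; split=> [|x a x' y xax' xy].
  exact: semi_bisimilar_sym.
have [[-> [y' [_ [xy' x'y']]]]|] := hB.2 _ _ _ _ xax' xy; last by right.
left; split=> //; apply: semi_bisimilar_trans x'y' _.
exact: semi_bisimilar_trans (semi_bisimilar_sym xy') xy.
Qed.

(** The quotient map, with classes encoded as subsets; its target is all of [set X]. *)
Definition semi_class x : set X := semi_bisimilar x.

Lemma semi_classP x y : semi_class x = semi_class y <-> semi_bisimilar x y.
Proof.
split=> [e|xy].
  by rewrite -/(semi_class x y) e; exact: semi_bisimilar_refl.
apply/seteqP; split=> z; apply: semi_bisimilar_trans => //.
exact: semi_bisimilar_sym.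
Qed.

(** * Matching executions up to stutter equivalence in the quotient *)

Local Notation cl := (path_comp semi_class).

Definition tau_word (w : word A) := exists n, w = nseq n None.

Lemma tau_word_rcons w : tau_word w -> tau_word (rcons w None).
Proof. by move=> [n ->]; exists n.+1; rewrite -[n.+1]addn1 nseqD cats1. Qed.

(** By the stuttering property all states between [y] and [y'] have the same class, so each appended
    silent step stutters in the quotient. *)
Lemma exec_append_stutter x q y y' : exec tr x q -> tau_word (trace q) ->
  q (trace q) = Some y -> reach y y' -> semi_bisimilar y y' ->
  exists q', [/\ exec tr x q', tau_word (trace q'),
    q' (trace q') = Some y' & st (cl q') = st (cl q)].
Proof.
move=> hq tq ey yy'; have r := clos_rt_rt1n _ _ _ _ yy'.
elim: r q hq tq ey {yy'} => {y y'} [y|y z y' yz].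
  by move=> q; exists q.
move=> r IH q hq tq ey yy'; have zy' := clos_rt1n_rt _ _ _ _ r.
have byz := semi_bisimilar_stuttering (rt_step _ _ _ _ yz) zy' yy'.
have [||||q' [h1 h2 h3 h4]] := IH (snoc_path q None z).
- exact: exec_snoc hq ey yz.
- exact: tau_word_rcons.
- exact: snoc_path_last.
- exact: semi_bisimilar_trans (semi_bisimilar_sym byz) yy'.
exists q'; split=> //; rewrite h4 path_comp_snoc st_snoc_stutter//=.
by rewrite ey; congr Some; apply/semi_classP.
Qed.

(** The answer is [q] itself for an inert step; otherwise [q] is prolonged by stuttering silent
    steps and then by a step labelled [a]. The conclusion for silent [a] lets the match be
    iterated. *)
Lemma exec_snoc_match x y p q a x' :
  exec tr x (snoc_path p a x') -> exec tr y q -> tau_word (trace q) ->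
  st (cl q) = st (cl p) ->
  exists q', [/\ exec tr y q',
    tau_word (trace q') \/ exists2 w, tau_word w & trace q' = rcons w a,
    a = None -> tau_word (trace q')
    & st (cl q') = st (cl (snoc_path p a x'))].
Proof.
move=> hpx hq tq e; have [hp [z ez zax']] := exec_snoc_inv hpx.
(* Stutter equivalent paths end in the same state, here the common class of [z] and the last state
   [u] of [q]. *)
have := st_last (cl q); rewrite e st_last /= ez /=.
case ey : (q (trace q)) => [u|] //= -[/semi_classP zu].
have [[-> x'u]|[y' [y'' [r [t [zy' x'y'']]]]]] :=
  semi_bisimilar_branching.2 _ _ _ _ zax' zu.
  exists q; split=> //; first by left.
  rewrite e path_comp_snoc st_snoc_stutter//= ez; congr Some; apply/semi_classP.
  exact: semi_bisimilar_trans zu (semi_bisimilar_sym x'u).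
have uy' := semi_bisimilar_trans (semi_bisimilar_sym zu) zy'.
have [q' [h1 h2 h3 h4]] := exec_append_stutter hq tq ey r uy'.
exists (snoc_path q' a y''); split.
- exact: exec_snoc h1 h3 t.
- by right; exists (trace q').
- by move=> ->; exact: tau_word_rcons.
rewrite !path_comp_snoc (semi_classP x' y'').2//.
by apply: st_snoc_congr; rewrite h4.
Qed.

Lemma exec_tau_match x y p : semi_bisimilar x y ->
  exec tr x p -> tau_word (trace p) ->
  exists q, [/\ exec tr y q, tau_word (trace q) & st (cl q) = st (cl p)].
Proof.
move=> xy hp [n et]; elim: n p hp et => [|n IH] p hp et.
  exists (unit_path y); split; [exact: exec_unit|by exists 0|].
  congr st; apply: path_ext_dom => //= w /prefix_of_0 ->.
  by rewrite hp.1; case: pselect => //= _; congr Some; apply/esym/semi_classP.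
move: et; rewrite -[n.+1]addn1 nseqD cats1 => /path_rcons[p0 [x' [et0 ep]]].
move: hp; rewrite ep => hp; have hp0 := (exec_snoc_inv hp).1.
have [q [hq tq e]] := IH _ hp0 et0.
by have [q' [? _ h ?]] := exec_snoc_match hp hq tq e; exists q'; split=> //; exact: h.
Qed.

(** The answer may omit an inert last step; its trace is then silent, possibly empty, and it lies in
    the second component of [alpha]. *)
Lemma alpha_match x y p : semi_bisimilar x y -> alpha tr x p ->
  exists2 q, alpha tr y q & st (cl q) = st (cl p).
Proof.
move=> xy [[hp [n [a /path_rcons[p0 [x' [et0 ep]]]]]]|[hp tp]]; last first.
  by have [q [hq tq e]] := exec_tau_match xy hp tp; exists q => //; right.
move: hp; rewrite ep => hp; have hp0 := (exec_snoc_inv hp).1.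
have [|q [hq tq e]] := exec_tau_match xy hp0; first by exists n.
have [q' [h1 h2 _ h4]] := exec_snoc_match hp hq tq e; exists q' => //.
case: h2 => [?|[_ [m ->] ew]]; first by right.
by left; split=> //; exists m, a.
Qed.

Lemma semi_class_image x y : semi_bisimilar x y ->
  PStPath_map semi_class (lts_coalgebra tr x) `<=`
  PStPath_map semi_class (lts_coalgebra tr y).
Proof.
move=> xy _ [_ [p hp <-] <-]; have [q hq e] := alpha_match xy hp.
exists (st_class q); first by exists q.
by rewrite !StPath_map_class; apply/st_classP.
Qed.

End SemiBranching.

(** * Kernels of coalgebra morphisms *)

Lemma coalgebra_kernel_branching A X Y (tr : X -> option A -> X -> Prop)
    (beta : Y -> PStPath A Y) (f : X -> Y) :
  PStPath_map f \o lts_coalgebra tr = beta \o f ->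
  branching_bisimulation tr (fun x y => f x = f y).
Proof.
move=> comm; split=> // x a x' y xax' exy.
have [[-> e]|ninert] := pselect (a = None /\ f x = f x').
  by left; split=> //; rewrite -e.
right; pose p := snoc_path (unit_path x) a x'.
have hp : alpha tr x p.
  left; split; last by exists 0, a.
  by apply: exec_snoc xax'; [exact: exec_unit|exact: unit_pathE].
have p0 : p [::] = Some x.
  by rewrite snoc_path_prefix ?unit_pathE//; exact: prefix_of_refl.
have pa : p [:: a] = Some x' := snoc_path_last (unit_path x) a x'.
(* As the step is not inert, its image under [f] does not stutter. *)
have ba : stutter_basis (path_comp f p) [:: a] = [:: a].
  have [[e1 e2]|//] := stutter_basis_step (path_comp f p) [::] a.
  have : omap f (p [:: a]) = omap f (p [::]) := e2.
  rewrite p0 pa => -[exx'].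
  have [b ea] : exists b, a = Some b by case: (a) ninert => [b|[]] //; exists b.
  by move: e1; rewrite [in rcons _ _]ea stutter_basis_act.
have : PStPath_map f (lts_coalgebra tr x) (st_class (path_comp f p)).
  by exists (st_class p); [exists p|rewrite StPath_map_class].
have -> : PStPath_map f (lts_coalgebra tr x) = PStPath_map f (lts_coalgebra tr y).
  by have := congr1 (@^~ x) comm; have := congr1 (@^~ y) comm => /= -> ->; rewrite exy.
move=> [_ [q hq <-]]; rewrite StPath_map_class => /st_classP e.
have {}hq : exec tr y q by case: hq => -[].
(* Equal stutter invariant paths have equal traces, so exactly one step of [q] is seen by [f], and
   it carries the letter [a]. *)
have : stutter_basis (path_comp f q) (trace q) = [:: a].
  by have /= := congr1 (@trace _ _) e; rewrite ba.
move=> /stutter_basis_letter[w [hwa b0 b1]].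
have hw := prefix_of_rconsW hwa.
(* Evaluated at the empty word and at [[:: a]], this gives the images under [f] of the states before
   and after that step. *)
have stE v : st_fun (path_comp f q) v = st_fun (path_comp f p) v.
  by have := congr1 (fun r : Path A Y => r v) e.
have fq0 : omap f (q w) = Some (f x).
  have := stE [::]; rewrite -{1}b0 st_fun_basis// => /= ->.
  rewrite -[X in st_fun _ X](stutter_basis_nil (path_comp f p)) st_fun_basis.
    by rewrite [LHS]/(omap f (p [::])) p0.
  exact: prefix_of_nil.
have fq1 : omap f (q (rcons w a)) = Some (f x').
  have := stE [:: a]; rewrite -{1}b1 st_fun_basis// => /= ->.
  rewrite -[X in st_fun _ X]ba st_fun_basis.
    by rewrite [LHS]/(omap f (p [:: a])) pa.
  exact: prefix_of_refl.
case ey' : (q w) fq0 => [y'|//] -[fy'].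
case ey'' : (q (rcons w a)) fq1 => [y''|//] -[fy''].
exists y', y''; do !split=> //; last exact: hq.2 ey' ey''.
have [n ew] := stutter_basis_nil_tau b0.
by apply: (exec_tau_reach (n := n) hq); rewrite -ew.
Qed.

Theorem theorem15 (A X : Type) (tr : X -> option A -> X -> Prop) (x x' : X) :
  branching_bisimilar tr x x' <->
  behaviourally_equivalent (@PStPath_map A) (lts_coalgebra tr) x x'.
Proof.
split=> [[R [hR xx']]|[Y [beta [f [comm e]]]]]; last first.
  by exists (fun u v => f u = f v); split=> //; exact: coalgebra_kernel_branching comm.
pose f := semi_class tr.
(* The structure map takes the union of the images over all states of class [c], which is empty if
   [c] is not a class. By [semi_class_image] this union is the image at any one representative. *)
exists (set X), (fun c => [set d | exists2 u, f u = c &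
  PStPath_map f (lts_coalgebra tr u) d]), f; split; last first.
  by apply/semi_classP; exists R; split=> //; exact: branching_semi.
apply/funext => u /=; apply/seteqP; split=> [d|d [v /semi_classP vu]].
  by exists u.
exact: semi_class_image.
Qed.
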